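(* Let $P$ be any finite poset. Then, as $n\to\infty$, $$\operatorname{La}^{\#}(n,P)\sim\frac{|P|}{c(P)}\binom{n}{\lfloor n/2\rfloor},$$ where $\operatorname{La}^{\#}(n,P)$ and $c(P)$ are as defined in the context.
   Context: For $n\ge 0$, $\mathcal{B}_n$ denotes the Boolean lattice: the family of all subsets of $[n]=\{1,\dots,n\}$ ordered by inclusion. A weak embedding of a finite poset $P$ into $\mathcal{B}_n$ is an injective map $f:P\to\mathcal{B}_n$ such that $a<b$ in $P$ implies $f(a)\subsetneq f(b)$; its image $f(P)$ is called a copy of $P$ in $\mathcal{B}_n$. Copies $\mathcal{F}_1,\mathcal{F}_2,\dots$ of $P$ are pairwise unrelated if whenever $i\ne j$, $A\in\mathcal{F}_i$ and $A'\in\mathcal{F}_j$, the sets $A$ and $A'$ are incomparable under inclusion (neither contains the other). $\operatorname{La}^{\#}(n,P)$ denotes the maximum of $|\bigcup_i\mathcal{F}_i|$ over all families of pairwise unrelated copies $\mathcal{F}_i$ of $P$ in $\mathcal{B}_n$. For $\mathcal{F}\subseteq\mathcal{B}_k$, its convex closure is $\overline{\mathcal{F}}=\{S\in\mathcal{B}_k : A\subseteq S\subseteq B \text{ for some } A,B\in\mathcal{F}\}$. Finally, $c(P)$ is the minimum of $|\overline{f(P)}|$ over all $k\ge0$ and all weak embeddings $f$ of $P$ into $\mathcal{B}_k$. *)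

(* Defs.v *)
From mathcomp Require Import all_boot all_order.
From mathcomp Require Import boolp.

Set Implicit Arguments.
Unset Strict Implicit.
Unset Printing Implicit Defensive.

Section PosetCopies.

Context {d : Order.disp_t} (P : finPOrderType d).

Definition weak_embedding (n : nat) (f : {ffun P -> {set 'I_n}}) : bool :=
  injectiveb f && [forall a, forall b, (a < b)%O ==> (f a \proper f b)].

Definition copy (n : nat) (F : {set {set 'I_n}}) : bool :=
  [exists f : {ffun P -> {set 'I_n}}, weak_embedding f && (F == f @: P)].

(* Repetitions in an indexed family never matter: a nonempty copy is related to
   itself, and an empty one contributes nothing to the union. *)
Definition unrelated_copies (n : nat) (C : {set {set {set 'I_n}}}) : bool :=
  [forall F in C, copy F] &&
  [forall F in C, forall F' in C, (F != F') ==>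
    [forall A in F, forall A' in F', ~~ (A \subset A') && ~~ (A' \subset A)]].

Definition La_sharp (n : nat) : nat :=
  \max_(C : {set {set {set 'I_n}}} | unrelated_copies C) #|cover C|.

Definition convex_closure (k : nat) (F : {set {set 'I_k}}) : {set {set 'I_k}} :=
  [set S : {set 'I_k} | [exists A in F, exists B in F, (A \subset S) && (S \subset B)]].

Definition hull_size (m : nat) : Prop :=
  exists k (f : {ffun P -> {set 'I_k}}),
    weak_embedding f /\ #|convex_closure (f @: P)| = m.

Lemma hull_size_ex : exists m, `[< hull_size m >].
Proof.
pose f : {ffun P -> {set 'I_#|P|}} := [ffun a => [set i | (enum_val i <= a)%O]].
have fE a b : (enum_rank b \in f a) = (b <= a)%O.
  by rewrite ffunE inE enum_rankK.
have fS a b : (f a \subset f b) = (a <= b)%O.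
  apply/idP/idP => [/subsetP sab|le_ab]; first by rewrite -fE sab ?fE.
  apply/subsetP => i; rewrite -[i]enum_valK !fE => le_ia.
  exact: Order.POrderTheory.le_trans le_ab.
exists #|convex_closure (f @: P)|; apply/asboolP; exists #|P|, f; split=> //.
apply/andP; split.
  apply/injectiveP => a b eq_ab; apply/Order.POrderTheory.le_anti.
  by rewrite -!fS eq_ab subxx.
apply/forallP => a; apply/forallP => b; apply/implyP => lt_ab.
by rewrite properE !fS Order.POrderTheory.ltW ?Order.POrderTheory.lt_geF.
Qed.

Definition min_hull : nat := ex_minn hull_size_ex.

End PosetCopies.

(* Main.v *)
(** Upper bound.  The convex closures of pairwise unrelated copies are pairwise
    unrelated, so a maximal chain meets at most one of them.  Keep [c(P)] members
    of each closure and let [U] be their union.  For a uniformly random maximal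
    chain and nontrivial [A] properly included in [B],
    [n * Pr(A, B in chain) <= Pr(A in chain) + Pr(B in chain)],
    so pairs are negligible and the LYM inequality for [U] loses only a factor
    [1 - 2c(P)/n].

    Lower bound.  Let [G] be an optimal closure in the cube of dimension [k].
    Splitting off [k] coordinates, use [G] on them with every possible remainder,
    and recurse on the remainder wherever the first part lies outside [G].  The
    parts form an acyclic arrangement: since [G] is convex, it can be contracted
    to a point, so the copies carry levels dropping strictly along inclusions
    between different copies.  This covers a share of the cube of dimension [kt]
    tending to 1.  On the other [m] coordinates, add to a copy of level [l] all
    sets of size [m/2 + l]; the levels make the results unrelated, and they are
    close enough to the middle to be counted by the central binomial. *)

Require Import Defs.
From mathcomp Require Import all_boot all_order all_algebra.
From mathcomp Require Import fingroup perm zify ring lra.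
From mathcomp Require boolp.

Set Implicit Arguments.
Unset Strict Implicit.
Unset Printing Implicit Defensive.

(** * Elementary bounds on binomial coefficients *)

Lemma leq_bin_half n k : 'C(n, k) <= 'C(n, n./2).
Proof.
have low d : 'C(n, n./2 - d) <= 'C(n, n./2).
  elim: d => [|d IHd]; first by rewrite subn0.
  have [le_hd|lt_dh] := leqP n./2 d; first by move: IHd; congr ('C(n, _) <= _); lia.
  apply: leq_trans IHd; rewrite subnS.
  set j := n./2 - d; have j_gt0 : 0 < j by lia.
  have := mul_bin_left n j.-1; rewrite prednK // => eq_bin.
  rewrite -(leq_pmul2l j_gt0) eq_bin leq_mul2r; apply/orP; right; lia.
have [le_kh|lt_hk] := leqP k n./2; first by rewrite -(subKn le_kh) low.
have [le_kn|lt_nk] := leqP k n; last by rewrite bin_small.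
rewrite -bin_sub //; have -> : n - k = n./2 - (n./2 - (n - k)) by lia.
exact: low.
Qed.

Lemma leq_bin_id n k : 0 < k < n -> n <= 'C(n, k).
Proof.
elim: n k => [|n IHn] [|k] //=; rewrite ltnS => lt_kn; rewrite binS.
have [lt_k1n|lt_nk|eq_kn] := ltngtP k.+1 n; last 1 first.
- by rewrite -eq_kn binn binSn.
- have := IHn k.+1 lt_k1n; have : 0 < 'C(n, k) by rewrite bin_gt0; lia.
  lia.
- lia.
Qed.

(** * Random maximal chains *)

(** The list [s C] runs through [C], then the rest of [B], then the complement of [B]. Matching
    [s A] with [s A'] position by position respects all three blocks, since [A] and [A'] have equal
    size. This symmetry makes chain counts depend on sizes only. *)
Lemma perm_flag (T : finType) (A A' B : {set T}) :
  A \subset B -> A' \subset B -> #|A| = #|A'| ->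
  exists t : {perm T}, t @: A = A' /\ t @: B = B.
Proof.
move=> sAB sA'B eqAA'; pose s (C : {set T}) := enum C ++ enum (B :\: C) ++ enum (~: B).
have mem_s (C : {set T}) x : C \subset B -> x \in s C.
  move=> /subsetP sCB; rewrite !mem_cat !mem_enum !inE.
  by case: (x \in C) (sCB x) => [->|] //; case: (x \in B).
have uniq_s (C : {set T}) : C \subset B -> uniq (s C).
  move=> /subsetP sCB; rewrite !cat_uniq !enum_uniq /= andbT.
  rewrite has_cat negb_or -andbA; apply/and3P; split.
  - by apply/hasPn => x; rewrite /= !mem_enum !inE => /andP[].
  - by apply/hasPn => x; rewrite /= !mem_enum !inE; apply: contra => /sCB.
  by apply/hasPn => x; rewrite /= !mem_enum !inE => /negPf ->; rewrite andbF.
have size_s (C : {set T}) : C \subset B -> size (s C) = #|T|.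
  move=> sCB; rewrite cardE; apply/perm_size/uniq_perm; rewrite ?enum_uniq ?uniq_s //.
  by move=> x; rewrite mem_s // mem_enum.
have [uA uA'] := (uniq_s _ sAB, uniq_s _ sA'B).
have [zA zA'] := (size_s _ sAB, size_s _ sA'B).
have lt_idx x : index x (s A) < #|T| by rewrite -zA index_mem mem_s.
pose f x := nth x (s A') (index x (s A)).
have f_inj : injective f.
  move=> x y; rewrite /f (set_nth_default x y) ?zA' // => /eqP.
  rewrite nth_uniq ?zA' // => /eqP eq_xy.
  by rewrite -(nth_index x (mem_s A x sAB)) eq_xy nth_index // mem_s.
exists (perm f_inj).
have imA : perm f_inj @: A = A'.
  apply/eqP; rewrite eqEcard card_imset ?eqAA' ?leqnn ?andbT; last exact: perm_inj.
  apply/subsetP => _ /imsetP[x Ax ->]; rewrite permE /f index_cat mem_enum Ax.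
  have lt_x : index x (enum A) < #|A| by rewrite cardE index_mem mem_enum.
  by rewrite nth_cat -cardE -eqAA' lt_x -mem_enum mem_nth // -cardE -eqAA'.
split=> //; apply/eqP; rewrite eqEcard card_imset ?leqnn ?andbT; last exact: perm_inj.
apply/subsetP => _ /imsetP[x Bx ->]; have [Ax|nAx] := boolP (x \in A).
  by apply: (subsetP sA'B); rewrite -imA imset_f.
rewrite permE /f !index_cat mem_enum (negPf nAx) mem_enum !inE nAx Bx /=.
have lt_x : index x (enum (B :\: A)) < #|B :\: A|.
  by rewrite cardE index_mem mem_enum !inE nAx.
rewrite nth_cat -!cardE -eqAA' ltnNge leq_addr /= addKn nth_cat -cardE.
have -> : #|B :\: A'| = #|B :\: A|.
  by rewrite !cardsD (setIidPr sAB) (setIidPr sA'B) eqAA'.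
rewrite lt_x; set y := nth _ _ _; suff : y \in B :\: A' by rewrite inE => /andP[].
rewrite -mem_enum mem_nth // -cardE; move: lt_x.
by rewrite !cardsD (setIidPr sAB) (setIidPr sA'B) eqAA'.
Qed.

Definition initial_segment n k := [set i : 'I_n | i < k].

(* [s] encodes the maximal chain of all [s @: initial_segment n k]. *)
Definition in_chain {n} (s : 'S_n) (A : {set 'I_n}) : bool :=
  s @: initial_segment n #|A| == A.

Lemma card_initial_segment n k : k <= n -> #|initial_segment n k| = k.
Proof.
move=> le_kn; rewrite cardE -(size_map val) -[RHS](size_iota 0).
apply/perm_size/uniq_perm; rewrite ?iota_uniq ?map_inj_uniq ?enum_uniq //.
  exact: val_inj.
move=> i; rewrite mem_iota add0n /=; apply/mapP/idP => [[j]|lt_ik].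
  by rewrite mem_enum inE => lt_jk ->.
by exists (Ordinal (leq_trans lt_ik le_kn)); rewrite ?mem_enum ?inE.
Qed.

Lemma initial_segmentS n k l : k <= l -> initial_segment n k \subset initial_segment n l.
Proof. by move=> le_kl; apply/subsetP => i; rewrite !inE => /leq_trans ->. Qed.

Lemma card_sub_ord n (A : {set 'I_n}) : #|A| <= n.
Proof. by rewrite -[X in _ <= X]card_ord max_card. Qed.

Lemma cardsC_ord n (A : {set 'I_n}) : #|~: A| = n - #|A|.
Proof. by rewrite cardsCs setCK card_ord. Qed.

Lemma in_chain_sub n (s : 'S_n) (A B : {set 'I_n}) :
  in_chain s A -> in_chain s B -> #|A| <= #|B| -> A \subset B.
Proof.
move=> /eqP {2}<- /eqP {2}<- le_AB; exact/imsetS/initial_segmentS.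
Qed.

Lemma in_chainM n (s t : 'S_n) (A : {set 'I_n}) :
  in_chain (s * t)%g (t @: A) = in_chain s A.
Proof.
rewrite /in_chain card_imset; last exact: perm_inj.
have -> : (s * t)%g @: initial_segment n #|A| = t @: (s @: initial_segment n #|A|).
  by rewrite -imset_comp; apply: eq_imset => i; rewrite /= permM.
by rewrite (inj_eq (imset_inj _)) //; exact: perm_inj.
Qed.

Definition chain_count {n} (A B : {set 'I_n}) : nat :=
  #|[set s : 'S_n | in_chain s A && in_chain s B]|.

Lemma chain_count_imset n (A B : {set 'I_n}) (t : 'S_n) :
  chain_count (t @: A) (t @: B) = chain_count A B.
Proof.
rewrite /chain_count -(card_preimset _ (mulIg t)); apply: eq_card => s.
by rewrite !inE !in_chainM.
Qed.

(** Double counting of pairs of a chain through [B] and a member of it of size [#|A|]. By symmetry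
    each subset of [B] of that size contributes [chain_count A B], and each chain through [B] has
    exactly one such member. *)
Lemma bin_chain_count n (A B : {set 'I_n}) : A \subset B ->
  'C(#|B|, #|A|) * chain_count A B = chain_count B B.
Proof.
move=> sAB; rewrite -cards_draws -sum_nat_const.
transitivity (\sum_(A' in [set A' : {set 'I_n} | A' \subset B & #|A'| == #|A|])
                chain_count A' B).
  apply: eq_bigr => A'; rewrite inE => /andP[sA'B /eqP eqAA'].
  have [t [<- {2}<-]] := perm_flag sAB sA'B (esym eqAA').
  by rewrite chain_count_imset.
rewrite /chain_count; under eq_bigr do rewrite -sum1dep_card big_mkcondr /=.
rewrite (exchange_big_dep xpredT) //= -sum1dep_card.
rewrite [RHS]big_mkcond; apply: eq_bigr => s _; rewrite andbb.
case: ifP => sB; last by rewrite big1.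
have le_AB := subset_leq_card sAB; have le_Bn := card_sub_ord B.
pose A0 := s @: initial_segment n #|A|.
have cA0 : #|A0| = #|A|.
  by rewrite card_imset ?card_initial_segment ?(leq_trans le_AB) //; exact: perm_inj.
have sA0 : in_chain s A0 by rewrite /in_chain cA0.
rewrite (big_pred1 A0) // => A' /=; rewrite inE.
apply/idP/eqP => [/andP[/andP[_ /eqP cA'] /eqP <-]|->]; first by rewrite cA'.
by rewrite sA0 (in_chain_sub sA0 sB) cA0 // eqxx.
Qed.

Lemma chain_countC n (A B : {set 'I_n}) : chain_count (~: A) (~: B) = chain_count A B.
Proof.
(* Reversing the order of the points turns initial segments into final ones, so the chain of [r * s]
   consists of the complements of the chain of [s]. *)
pose r := perm (@rev_ord_inj n).
rewrite /chain_count -(card_preimset _ (mulgI r)); apply: eq_card => s.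
suff rC (C : {set 'I_n}) : in_chain (r * s)%g (~: C) = in_chain s C by rewrite !inE !rC.
rewrite /in_chain.
have -> : (r * s)%g @: initial_segment n #|~: C| = ~: (s @: initial_segment n #|C|).
  apply/setP => i; rewrite inE -[i in LHS](permKV s) -[i in RHS](permKV s).
  set j := (s^-1)%g i; rewrite (mem_imset _ _ perm_inj) !inE.
  have -> : s j = (r * s)%g (rev_ord j) by rewrite permM permE rev_ordK.
  rewrite (mem_imset _ _ perm_inj) inE /= -leqNgt.
  rewrite cardsC_ord; have := ltn_ord j; have := card_sub_ord C.
  by move: #|C| => c; move: (nat_of_ord j) => l; lia.
by rewrite (inj_eq (@setC_inj _)).
Qed.

Lemma in_chainT n (s : 'S_n) : in_chain s setT.
Proof.
rewrite /in_chain eqEcard subsetT card_imset; last exact: perm_inj.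
by rewrite card_initial_segment ?card_sub_ord ?leqnn.
Qed.

Lemma bin_chain_count1 n (A : {set 'I_n}) : 'C(n, #|A|) * chain_count A A = n`!.
Proof.
have := bin_chain_count (subsetT A); rewrite cardsT card_ord.
have -> : chain_count A setT = chain_count A A.
  by apply: eq_card => s; rewrite !inE in_chainT andbT ?andbb.
move=> ->; rewrite -card_Sn; apply: eq_card => s; rewrite !inE in_chainT.
by [].
Qed.

(** The double count, applied to [A] in [B] and to the complements, writes both terms on the right
    as binomial multiples of [chain_count A B]. These binomials are at least [#|B|] and [n - #|A|],
    whose sum exceeds [n]. *)
Lemma chain_count_pair n (A B : {set 'I_n}) :
  A \proper B -> A != set0 -> B != setT ->
  n * chain_count A B <= chain_count A A + chain_count B B.
Proof.
move=> ltAB; have /andP[sAB _] := ltAB; rewrite -card_gt0 => A_gt0 BT.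
have lt_card := proper_card ltAB.
have B_ltn : #|B| < n.
  by rewrite -[X in _ < X]card_ord -cardsT proper_card // properT.
have := bin_chain_count sAB.
have := @bin_chain_count _ (~: B) (~: A); rewrite setCS => /(_ sAB).
have chain_countN C D : chain_count D C = chain_count C D :> nat.
  by apply: eq_card => s; rewrite !inE andbC.
rewrite !chain_countC [chain_count B A]chain_countN => <- <-.
rewrite -mulnDl leq_mul2r !cardsC_ord; apply/orP; right.
have := @leq_bin_id #|B| #|A|; have := @leq_bin_id (n - #|A|) (n - #|B|); lia.
Qed.

Lemma chain_countE n (A B : {set 'I_n}) :
  chain_count A B = \sum_(s : 'S_n) (in_chain s A && in_chain s B).
Proof. by rewrite /chain_count -sum1dep_card big_mkcond. Qed.

(* Inside one chain, every member but the largest lies below the largest. *)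
Lemma chain_bonferroni n (s : 'S_n) (U : {set {set 'I_n}}) :
  \sum_(A in U) in_chain s A <=
    1 + \sum_(A in U) \sum_(B in U | A \proper B) (in_chain s A && in_chain s B).
Proof.
have [A1 /andP[UA1 sA1]|noA] := pickP [pred A in U | in_chain s A]; last first.
  by rewrite big1 // => A UA; have := noA A; rewrite /= UA => /= ->.
have [|A0 /andP[UA0 sA0] maxA0] :=
  @arg_maxnP _ A1 [pred A in U | in_chain s A] (fun A => #|A|); first exact/andP.
rewrite (bigD1 A0) //= sA0 leq_add2l [X in _ <= X](bigD1 A0) //=.
apply: leq_trans (leq_addl _ _); apply: leq_sum => A /andP[UA neqA].
case sA: (in_chain s A) => //; have sub : A \subset A0.
  by apply: (in_chain_sub sA sA0); apply: maxA0; rewrite /= UA.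
have ltA : A \proper A0 by rewrite properEneq neqA.
by rewrite (bigD1 A0) ?UA0 //= sA0.
Qed.

(** LYM with a correction: [S <= n! + T] and [n * T <= 2 * D * S] give [S * (n - 2 * D) <= n * n!],
    while every member of [U] adds at least [n! / 'C(n, n./2)] to [S]. *)
Lemma leq_card_half_bin n D (U : {set {set 'I_n}}) :
  set0 \notin U -> setT \notin U ->
  (forall A, A \in U -> #|[set B in U | A \proper B]| <= D) ->
  (forall B, B \in U -> #|[set A in U | A \proper B]| <= D) ->
  #|U| * (n - 2 * D) <= n * 'C(n, n./2).
Proof.
move=> U0 UT upD downD.
pose N (A : {set 'I_n}) := chain_count A A; pose S := \sum_(A in U) N A.
pose T := \sum_(A in U) \sum_(B in U | A \proper B) chain_count A B.
have chains : S <= n`! + T.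
  have -> : S = \sum_(s : 'S_n) \sum_(A in U) in_chain s A.
    rewrite exchange_big; apply: eq_bigr => A _; rewrite /N chain_countE.
    by apply: eq_bigr => s _; rewrite andbb.
  have -> : T = \sum_(s : 'S_n) \sum_(A in U) \sum_(B in U | A \proper B)
                   (in_chain s A && in_chain s B).
    rewrite exchange_big; apply: eq_bigr => A _; rewrite exchange_big.
    by apply: eq_bigr => B _; rewrite chain_countE.
  rewrite -card_Sn -[#|_|]sum1_card -big_split /=.
  by apply: leq_sum => s _; exact: chain_bonferroni.
(* A member of [U] is the smaller set of at most [D] pairs and the larger set of at most [D]
   pairs. *)
have pairs : n * T <= 2 * D * S.
  rewrite mul2n -addnn mulnDl.
  apply: (@leq_trans (\sum_(A in U) \sum_(B in U | A \proper B) (N A + N B))).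
    rewrite big_distrr; apply: leq_sum => A UA /=; rewrite big_distrr.
    apply: leq_sum => B /andP[UB ltAB]; apply: chain_count_pair => //.
      by apply: contraNneq U0 => <-.
    by apply: contraNneq UT => <-.
  under eq_bigr do rewrite big_split; rewrite big_split /= leq_add //.
    rewrite big_distrr; apply: leq_sum => A UA /=.
    by rewrite sum_nat_cond_const leq_mul2r upD ?orbT.
  rewrite (exchange_big_dep (mem U)) => [|A B _ /andP[]//] /=.
  rewrite big_distrr; apply: leq_sum => B UB /=.
  under eq_bigl do rewrite UB /=.
  by rewrite sum_nat_cond_const leq_mul2r downD ?orbT.
have size : #|U| * n`! <= S * 'C(n, n./2).
  rewrite -sum_nat_const big_distrl; apply: leq_sum => A UA /=.
  by rewrite -(bin_chain_count1 A) mulnC leq_mul2l leq_bin_half orbT.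
rewrite -(leq_pmul2l (fact_gt0 n)) mulnA [n`! * _]mulnC.
apply: leq_trans (leq_mul size (leqnn (n - 2 * D))) _.
rewrite mulnAC mulnA leq_mul2r; apply/orP; right.
rewrite mulnBr leq_subLR [S * n]mulnC.
apply: leq_trans (leq_mul (leqnn n) chains) _.
by rewrite mulnDr addnC [n * n`!]mulnC leq_add // [S * _]mulnC.
Qed.

(** * Closures of unrelated copies *)

Lemma convex_closure_sub k (F : {set {set 'I_k}}) : F \subset convex_closure F.
Proof.
apply/subsetP => A FA; rewrite inE; apply/existsP; exists A; rewrite FA.
by apply/existsP; exists A; rewrite FA subxx.
Qed.

Lemma convex_closureP k (F : {set {set 'I_k}}) (S : {set 'I_k}) :
  reflect (exists A B, [/\ A \in F, B \in F, A \subset S & S \subset B])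
    (S \in convex_closure F).
Proof.
rewrite inE; apply: (iffP exists_inP) => [[A FA /exists_inP[B FB /andP[AS SB]]]|].
  by exists A, B.
move=> [A [B [FA FB AS SB]]]; exists A => //.
by apply/exists_inP; exists B => //; apply/andP.
Qed.

Lemma convex_closure_convex k (F : {set {set 'I_k}}) (A S B : {set 'I_k}) :
  A \in convex_closure F -> B \in convex_closure F -> A \subset S -> S \subset B ->
  S \in convex_closure F.
Proof.
move=> /convex_closureP[A1 [_ [FA1 _ sA1 _]]] /convex_closureP[_ [B1 [_ FB1 _ sB1]]] AS SB.
by apply/convex_closureP; exists A1, B1; rewrite (subset_trans sA1) ?(subset_trans SB).
Qed.

Lemma weak_embedding_inj d (P : finPOrderType d) n (f : {ffun P -> {set 'I_n}}) :
  weak_embedding f -> injective f.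
Proof. by case/andP => /injectiveP. Qed.

Lemma min_hull_attained d (P : finPOrderType d) :
  exists k (f : {ffun P -> {set 'I_k}}),
    weak_embedding f /\ #|convex_closure (f @: P)| = min_hull P.
Proof. by rewrite /min_hull; case: ex_minnP => m /boolp.asboolP. Qed.

Lemma min_hull_leq d (P : finPOrderType d) n (F : {set {set 'I_n}}) :
  copy P F -> min_hull P <= #|convex_closure F|.
Proof.
case/existsP => f /andP[fw /eqP ->]; rewrite /min_hull; case: ex_minnP => m _; apply.
by apply/boolp.asboolP; exists n, f.
Qed.

Lemma card_copy d (P : finPOrderType d) n (F : {set {set 'I_n}}) : copy P F -> #|F| = #|P|.
Proof.
by case/existsP => f /andP[/weak_embedding_inj f_inj /eqP ->]; rewrite card_imset.
Qed.

Lemma min_hull_gt0 d (P : finPOrderType d) : 0 < #|P| -> 0 < min_hull P.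
Proof.
have [k [f [fw <-]]] := min_hull_attained P => P_gt0.
apply: leq_trans (subset_leq_card (convex_closure_sub _)).
by rewrite card_imset //; exact: weak_embedding_inj fw.
Qed.

(** Below [S] lies a member of [F] and above [S'] a member of [F'], so an inclusion between closures
    yields one between the copies themselves. *)
Lemma unrelated_hulls d (P : finPOrderType d) n (C : {set {set {set 'I_n}}})
    (F F' : {set {set 'I_n}}) (S S' : {set 'I_n}) :
  unrelated_copies P C -> F \in C -> F' \in C ->
  S \in convex_closure F -> S' \in convex_closure F' -> S \subset S' -> F = F'.
Proof.
case/andP => _ /forall_inP unrel CF CF' /convex_closureP[A [_ [FA _ AS _]]].
move=> /convex_closureP[_ [B [_ FB _ SB]]] SS'; apply/eqP/negPn/negP => neqF.
have := unrel F CF => /forall_inP/(_ F' CF')/implyP/(_ neqF)/forall_inP/(_ A FA).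
by move=> /forall_inP/(_ B FB); rewrite (subset_trans AS) ?(subset_trans SS').
Qed.

Lemma card_unrelated_copies d (P : finPOrderType d) n (C : {set {set {set 'I_n}}}) :
  0 < #|P| -> unrelated_copies P C ->
  #|C| * (min_hull P * (n - 2 * min_hull P)) <= n * 'C(n, n./2).
Proof.
set c := min_hull P => P_gt0 unrel; have c_gt0 : 0 < c by exact: min_hull_gt0.
have /andP[/forall_inP copyC _] := unrel.
(* For [n <= 2 * c] the truncated subtraction makes the left side 0. *)
have [le_n2c|lt_2cn] := leqP n (2 * c).
  have -> : n - 2 * c = 0 by lia.
  by rewrite !muln0.
have le_c_bin : c <= 'C(n, n./2).
  apply: leq_trans (@leq_bin_id n n./2 _); lia.
(* [set0] and [setT] are comparable to every set, so if some closure contains one of them, [C] has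
   at most one member. *)
have [memC|memC] := boolP [exists F in C,
    (set0 \in convex_closure F) || (setT \in convex_closure F)].
  have {memC} C1 : #|C| <= 1.
    have /exists_inP[F CF extr] := memC.
    rewrite -(cards1 F) subset_leq_card //; apply/subsetP => F' CF'; rewrite inE.
    have : 0 < #|F'| by rewrite (card_copy (copyC _ CF')).
    rewrite card_gt0 => /set0Pn[A /(subsetP (convex_closure_sub F')) F'A].
    case/orP: extr => F0; apply/eqP.
      by rewrite (unrelated_hulls unrel CF CF' F0 F'A) // sub0set.
    by rewrite (unrelated_hulls unrel CF' CF F'A F0) // subsetT.
  apply: leq_trans (leq_mul C1 (leqnn _)) _; rewrite mul1n [c * _]mulnC.
  exact: leq_mul (leq_subr _ _) le_c_bin.
(* Each closure is cut down to exactly [c] members. A member of the union [U] is comparable only to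
   members of its own piece, so the degree bound holds with [D = c]. *)
pose G F := if F \in C then [set A in take c (enum (convex_closure F))] else set0.
have sG F A : A \in G F -> A \in convex_closure F.
  by rewrite /G; case: ifP; rewrite inE // => _ /mem_take; rewrite mem_enum.
have GC F A : A \in G F -> F \in C by rewrite /G; case: ifP; rewrite ?inE.
have cardG F : F \in C -> #|G F| = c.
  move=> CF; rewrite /G CF cardsE (card_uniqP _) ?take_uniq ?enum_uniq // size_take.
  by rewrite -cardE; have := min_hull_leq (copyC _ CF); rewrite -/c; case: ltngtP.
pose U := \bigcup_F G F.
have eqG F F' A A' : A \in G F -> A' \in G F' -> A \subset A' -> F = F'.
  by move=> GA GA'; apply: unrelated_hulls (sG _ _ GA) (sG _ _ GA'); eauto.
have cardU : #|U| = #|C| * c.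
  rewrite -sum1_card partition_disjoint_bigcup => [|F F' neqF]; last first.
    rewrite -setI_eq0; apply/eqP/setP => A; rewrite !inE; apply/negP => /andP[GA G'A].
    by rewrite (eqG _ _ _ _ GA G'A) ?subxx ?eqxx in neqF.
  rewrite -sum_nat_const [RHS]big_mkcond; apply: eq_bigr => F _; rewrite sum1_card.
  by case: ifP => [/cardG //|nCF]; rewrite /G nCF cards0.
rewrite mulnA -cardU; apply: leq_card_half_bin.
- apply: contra memC => /bigcupP[F _ GA]; apply/exists_inP; exists F; first exact: GC GA.
  by rewrite sG.
- apply: contra memC => /bigcupP[F _ GA]; apply/exists_inP; exists F; first exact: GC GA.
  by rewrite orbC sG.
- move=> A /bigcupP[F _ GA]; rewrite -(cardG F (GC _ _ GA)) subset_leq_card //.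
  apply/subsetP => B; rewrite inE => /andP[/bigcupP[F' _ GB] /proper_sub sAB].
  by rewrite (eqG _ _ _ _ GA GB).
- move=> B /bigcupP[F _ GB]; rewrite -(cardG F (GC _ _ GB)) subset_leq_card //.
  apply/subsetP => A; rewrite inE => /andP[/bigcupP[F' _ GA] /proper_sub sAB].
  by rewrite -(eqG _ _ _ _ GA GB).
Qed.

Lemma La_sharp_upper d (P : finPOrderType d) n : 0 < #|P| ->
  La_sharp P n * (min_hull P * (n - 2 * min_hull P)) <= #|P| * (n * 'C(n, n./2)).
Proof.
move=> P_gt0; rewrite /La_sharp; set c := _ * (n - _).
apply: (big_ind (fun x => x * c <= _)) => // [x y|C unrel].
  by rewrite maxnMl geq_max => ->.
have le_cover : #|cover C| <= #|P| * #|C|.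
  apply: leq_trans (leq_card_cover C) _; rewrite mulnC -sum_nat_const.
  apply: leq_sum => F CF; have /andP[/forall_inP copyC _] := unrel.
  by rewrite (card_copy (copyC _ CF)).
apply: leq_trans (leq_mul le_cover (leqnn c)) _.
by rewrite -mulnA leq_mul2l card_unrelated_copies ?orbT.
Qed.

(** * Leveled packings *)

Definition join_set k n (A : {set 'I_k}) (B : {set 'I_n}) : {set 'I_(k + n)} :=
  lshift n @: A :|: @rshift k n @: B.

Lemma join_setS k n (A A' : {set 'I_k}) (B B' : {set 'I_n}) :
  (join_set A B \subset join_set A' B') = (A \subset A') && (B \subset B').
Proof.
have inl C D i : (lshift n i \in @join_set k n C D) = (i \in C).
  rewrite inE (mem_imset _ _ (@lshift_inj _ _)); case: imsetP => [[j _ /eqP]|].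
    by rewrite eq_lrshift.
  by rewrite orbF.
have inr C D i : (rshift k i \in @join_set k n C D) = (i \in D).
  rewrite inE (mem_imset _ _ (@rshift_inj _ _)); case: imsetP => [[j _ /eqP]|] //.
  by rewrite eq_rlshift.
apply/idP/andP => [/subsetP sub|[sA sB]]; last by rewrite setUSS ?imsetS.
split; apply/subsetP => i; first by rewrite -(inl A B) -(inl A' B') => /sub.
by rewrite -(inr A B) -(inr A' B') => /sub.
Qed.

Lemma weak_embedding_mono d (P : finPOrderType d) k n
    (f : {ffun P -> {set 'I_k}}) (g : {ffun P -> {set 'I_n}}) :
  (forall a b, (g a \subset g b) = (f a \subset f b)) ->
  weak_embedding f -> weak_embedding g.
Proof.
move=> eq_fg /andP[/injectiveP f_inj /forallP f_lt]; apply/andP; split.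
  apply/injectiveP => a b eq_gab; apply: f_inj; apply/eqP.
  by rewrite eqEsubset -!eq_fg eq_gab subxx.
by apply/forallP => a; have := f_lt a; under eq_forallb do rewrite properE -!eq_fg -properE.
Qed.

(* Distinct copies are automatically disjoint: a common set would give
   [lev j < lev i] and [lev i < lev j]. *)
Definition leveled_packing {d} {P : finPOrderType d} {n} {I : finType}
    (e : I -> {ffun P -> {set 'I_n}}) (lev : I -> nat) : Prop :=
  (forall i, weak_embedding (e i)) /\
  (forall i j a b, e i a \subset e j b -> i = j \/ lev j < lev i).

(** The values fall into three bands: at most [k] for sets outside [G] that contain a member of [G],
    then [k.+1] on [G], then at least [k.+2] for all other sets. Going up never leads to a higher
    band: a step from the lowest band back into [G] is excluded by convexity. *)
Lemma convex_rank k (G : {set {set 'I_k}}) :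
  (forall A S B : {set 'I_k}, A \in G -> B \in G -> A \subset S -> S \subset B -> S \in G) ->
  exists r : {set 'I_k} -> nat,
    (forall A B : {set 'I_k}, A \in G -> B \in G -> r A = r B) /\
    (forall A B : {set 'I_k}, A \proper B -> ~~ ((A \in G) && (B \in G)) -> r B < r A).
Proof.
move=> convG; pose up (A : {set 'I_k}) := [exists B in G, B \subset A].
pose r (A : {set 'I_k}) := if A \in G then k.+1 else
  if up A then k - #|A| else k.+2 + (k - #|A|).
exists r; split=> [A B GA GB|A B ltAB nG]; first by rewrite /r GA GB.
have sAB := proper_sub ltAB; have lt_card := proper_card ltAB.
have le_Bk := card_sub_ord B.
have upG C : C \in G -> up C by move=> GC; apply/exists_inP; exists C.
have upS : up A -> up B.
  case/exists_inP => C GC sCA; apply/exists_inP; exists C => //.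
  exact: subset_trans sAB.
have upA : up A -> B \in G -> A \in G.
  by case/exists_inP => C GC sCA GB; exact: convG GC GB sCA sAB.
move: nG; rewrite /r; move: #|A| #|B| lt_card le_Bk => x y lt_xy le_yk.
case GA: (A \in G) => /=; case GB: (B \in G) => //= _.
- by rewrite upS ?upG //; lia.
- case uA: (up A); first by rewrite upA in GA.
  lia.
- case uA: (up A); first by rewrite upS //; lia.
  by case: ifP; lia.
Qed.

Lemma card_set_ord k : #|{set 'I_k}| = 2 ^ k.
Proof. by rewrite -[k in RHS]card_ord -cardsT -powersetT card_powerset cardsT. Qed.

Lemma leveled_packing_step d (P : finPOrderType d) k (f : {ffun P -> {set 'I_k}})
    n (I : finType) (e : I -> {ffun P -> {set 'I_n}}) lev :
  weak_embedding f -> leveled_packing e lev ->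
  exists (I' : finType) (e' : I' -> {ffun P -> {set 'I_(k + n)}}) lev',
    leveled_packing e' lev' /\
    #|I'| = 2 ^ n + (2 ^ k - #|convex_closure (f @: P)|) * #|I|.
Proof.
set G := convex_closure _ => fw [ew e_lev].
have [r [rG r_lt]] := convex_rank (@convex_closure_convex _ (f @: P)).
have Gf a : f a \in G by apply: (subsetP (convex_closure_sub _)); rewrite imset_f.
(* [W] exceeds [n] and all old levels, so [q * W + x] orders the pairs of first-part rank and
   remainder level lexicographically. *)
pose W := (n + \max_i lev i).+1.
have levW i : lev i < W by rewrite ltnS (leq_trans (leq_bigmax i)) ?leq_addl.
(* The default 0 is reached only if [G] is empty, that is, for empty [P]. *)
pose rk_G := if [pick A in G] is Some A then r A else 0.
have rk_GE A : A \in G -> r A = rk_G.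
  rewrite /rk_G; case: pickP => [B GB|G0] GA; first exact: rG.
  by have := G0 A; rewrite /= GA.
pose J := ({set 'I_n} + {A : {set 'I_k} | A \in ~: G} * I)%type.
pose e' (x : J) : {ffun P -> {set 'I_(k + n)}} := match x with
  | inl T => [ffun a => join_set (f a) T]
  | inr (A, i) => [ffun a => join_set (val A) (e i a)] end.
pose lev' (x : J) := match x with
  | inl T => rk_G * W + (n - #|T|)
  | inr (A, i) => r (val A) * W + lev i end.
have lexi q q' x x' : q < q' -> x < W -> q * W + x < q' * W + x'.
  by move=> lt_q lt_x; have := leq_mul lt_q (leqnn W); rewrite mulSn; lia.
have subW (T : {set 'I_n}) : n - #|T| < W by rewrite /W; lia.
exists J, e', lev'; split; last first.
  rewrite card_sum card_prod card_set_ord card_sig; congr (_ + _ * _).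
  transitivity #|~: G|; first exact: eq_card.
  by rewrite cardsCs setCK card_set_ord.
split=> [[T|[A i]]|[T|[[A nA] i]] [T'|[[A' nA'] j]] a b] /=.
- by apply: weak_embedding_mono fw => a b; rewrite !ffunE join_setS subxx andbT.
- by apply: weak_embedding_mono (ew i) => a b; rewrite !ffunE join_setS subxx.
- rewrite !ffunE join_setS => /andP[_ sT]; have [->|neqT] := eqVneq T T'; first by left.
  have lt_card : #|T| < #|T'| by rewrite proper_card // properEneq neqT.
  by right; rewrite ltn_add2l ltn_sub2l // (leq_trans lt_card) ?card_sub_ord.
- rewrite !ffunE join_setS => /andP[sA _]; right; apply: lexi (levW _).
  move: nA'; rewrite inE => nA'; rewrite -(rk_GE _ (Gf a)).
  apply: r_lt; last by rewrite (negPf nA') andbF.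
  by rewrite properEneq sA andbT; apply: contraNneq nA' => <-; exact: Gf.
- rewrite !ffunE join_setS => /andP[sA _]; right; apply: lexi (subW _).
  move: nA; rewrite inE => nA; rewrite -(rk_GE _ (Gf b)).
  apply: r_lt; last by rewrite (negPf nA).
  by rewrite properEneq sA andbT; apply: contraNneq nA => ->; exact: Gf.
- rewrite !ffunE join_setS => /andP[sA sE]; have [eqA|neqA] := eqVneq A A'.
    have [eq_ij|lt_ji] := e_lev _ _ _ _ sE; last by right; rewrite eqA ltn_add2l.
    by left; rewrite eq_ij; congr (inr (_, _)); exact: val_inj.
  right; apply: lexi (levW _); apply: r_lt; first by rewrite properEneq neqA.
  by move: nA; rewrite inE => /negPf ->.
Qed.

(* The share mu_t = |I| / 2^(kt) of indices satisfies mu_0 = 0 and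
   mu_(t+1) = 2^-k + (1 - c/2^k) mu_t, hence c mu_t = 1 - (1 - c/2^k)^t. *)
Lemma leveled_packing_exists d (P : finPOrderType d) k (f : {ffun P -> {set 'I_k}}) t :
  weak_embedding f ->
  exists n (I : finType) (e : I -> {ffun P -> {set 'I_n}}) lev,
    leveled_packing e lev /\
    let c := #|convex_closure (f @: P)| in
    2 ^ n * (2 ^ k) ^ t = (c * #|I|) * (2 ^ k) ^ t + 2 ^ n * (2 ^ k - c) ^ t.
Proof.
move=> fw; elim: t => [|t [n [I [e [lev [pack_e eq_card]]]]]].
  exists 0, void, (fun=> [ffun=> set0]), (fun=> 0); split; first by split; case.
  by rewrite /= card_void muln0.
have [I' [e' [lev' [pack_e' card_I']]]] := leveled_packing_step fw pack_e.
exists (k + n), I', e', lev'; split=> //=; move: eq_card; rewrite card_I' /=.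
set c := #|convex_closure _|; have le_c2k : c <= 2 ^ k.
  by rewrite -card_set_ord /c max_card.
rewrite !expnS expnD; move: (2 ^ k) (2 ^ n) (#|I|) le_c2k => K N M le_cK.
move: (subnKC le_cK); move: (K - c) => q eqK; move: (q ^ t) (K ^ t) => Q T eq_card.
(* As [c + q = K], the new identity is the old one times [K * q] with [c * N * K * T] added to both
   sides. *)
have := congr1 (muln (K * q)) eq_card; rewrite -eqK; lia.
Qed.

(** * From packings to unrelated copies, and binomials near the middle *)

Lemma La_sharp_lower d (P : finPOrderType d) n (I : finType)
    (e : I -> {ffun P -> {set 'I_n}}) lev m :
  0 < #|P| -> leveled_packing e lev ->
  #|P| * \sum_i 'C(m, m./2 + lev i) <= La_sharp P (n + m).
Proof.
move=> P_gt0 [ew e_lev].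
pose D := [set p : I * {set 'I_m} | #|p.2| == m./2 + lev p.1].
pose F (p : I * {set 'I_m}) : {ffun P -> {set 'I_(n + m)}} :=
  [ffun a => join_set (e p.1 a) p.2].
have Fw p : weak_embedding (F p).
  by apply: weak_embedding_mono (ew p.1) => a b; rewrite !ffunE join_setS subxx andbT.
(* Levels drop along inclusions between different copies while the sizes of the second parts grow
   with the level, so the second parts cannot be nested. Within one copy, equal sizes force equal
   second parts. *)
have FD p q a b : p \in D -> q \in D -> F p a \subset F q b -> p = q.
  case: p q => i Y [j Z]; rewrite !inE !ffunE join_setS /= => /eqP cY /eqP cZ.
  case/andP=> /e_lev[eq_ij|lt_ji] sYZ.
    move: cZ; rewrite -eq_ij => cZ.
    by congr (_, _); apply/eqP; rewrite eqEcard sYZ cY cZ leqnn.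
  by have := subset_leq_card sYZ; rewrite cY cZ leq_add2l leqNgt lt_ji.
pose C := [set F p @: P | p in D].
have unrel : unrelated_copies P C.
  apply/andP; split.
    by apply/forall_inP => _ /imsetP[p _ ->]; apply/existsP; exists (F p); rewrite Fw /=.
  apply/forall_inP => _ /imsetP[p Dp ->]; apply/forall_inP => _ /imsetP[q Dq ->].
  apply/implyP => neq; apply/forall_inP => _ /imsetP[a _ ->].
  apply/forall_inP => _ /imsetP[b _ ->].
  by apply/andP; split; apply: contraNN neq => /FD-> //.
have cover_C : #|P| * #|D| <= #|cover C|.
  pose g (x : P * (I * {set 'I_m})) := F x.2 x.1.
  have g_inj : {in setX setT D &, injective g}.
    case=> a p [b q]; rewrite !inE /= => Dp Dq; rewrite /g /= => eqF.
    have eq_pq : p = q by apply: (FD _ _ a b); rewrite ?inE ?eqF.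
    by rewrite eq_pq in eqF *; rewrite (weak_embedding_inj (Fw q) eqF).
  rewrite -[#|P|]cardsT -cardsX -(card_in_imset g_inj).
  apply: subset_leq_card; apply/subsetP => _ /imsetP[x + ->].
  rewrite inE => /andP[_ Dp].
  apply/bigcupP; exists (F x.2 @: P); last exact: imset_f.
  exact: (imset_f (fun p => F p @: P) Dp).
have card_D : #|D| = \sum_i 'C(m, m./2 + lev i).
  rewrite -sum1dep_card.
  rewrite -(pair_big_dep xpredT (fun i (Y : {set 'I_m}) => #|Y| == m./2 + lev i)
              (fun _ _ => 1)) /=.
  by apply: eq_bigr => i _; rewrite sum1dep_card card_draws card_ord.
rewrite -card_D (leq_trans cover_C) // /La_sharp.
exact: (leq_bigmax_cond (F := fun C : {set {set {set 'I_(n + m)}}} => #|cover C|)).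
Qed.

(** Moving from [h + l] to [h + l + 1] costs at most the fraction [(2l + 1) / h] of the central
    binomial, and the first [l] odd numbers sum to [l ^ 2]. *)
Lemma bin_half_shift m l :
  'C(m, m./2) * m./2 <= 'C(m, m./2 + l) * m./2 + l ^ 2 * 'C(m, m./2).
Proof.
set h := m./2; have le_2h : h.*2 <= m by rewrite -[X in _ <= X]odd_double_half leq_addl.
elim: l => [|l IHl]; first by rewrite addn0 leq_addr.
(* For [h <= l.+1 ^ 2] the error term alone dominates the left side. *)
have [le_hl|lt_lh] := leqP h (l.+1 ^ 2).
  by rewrite mulnC (leq_trans _ (leq_addl _ _)) ?leq_mul.
have lt_lh1 : l < h by move: lt_lh; rewrite expnS expn1 => lt_lh; nia.
have eq_bin := mul_bin_left m (h + l); rewrite addnS.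
have le_bin := leq_bin_half m (h + l); rewrite -/h in le_bin.
move: IHl eq_bin le_bin; rewrite !expnS !expn0 !muln1.
move: 'C(m, h) 'C(m, h + l) 'C(m, (h + l).+1) => c0 cl cl1 IHl eq_bin le_bin.
have : cl * (h - l) <= cl1 * (h + l).+1.
  by rewrite [cl1 * _]mulnC eq_bin mulnC leq_mul2r; apply/orP; right; lia.
rewrite mulnBr leq_subLR => le_step; have [le_cl|lt_cl] := leqP cl cl1; first nia.
have eq_cl := subnKC (ltnW lt_cl); move: (cl - cl1) eq_cl => e eq_cl.
have le_e : e * (h + l).+1 <= cl * (l + (h + l).+1 - h) by nia.
have {}le_e : e * h <= c0 * l.*2.+1 by nia.
nia.
Qed.

(** By Pascal's rule each new point at most doubles the central binomial. *)
Lemma central_bin_add n m : 'C(n + m, (n + m)./2) <= 2 ^ n * 'C(m, m./2).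
Proof.
elim: n => [|n IHn]; first by rewrite mul1n.
apply: (@leq_trans (2 * 'C(n + m, (n + m)./2))); last first.
  by rewrite expnS -mulnA leq_mul2l IHn.
rewrite addSn; case: (_.+1./2) => [|j]; last first.
  by rewrite binS mul2n -addnn leq_add ?leq_bin_half.
rewrite bin0; have : 0 < 'C(n + m, (n + m)./2) by rewrite bin_gt0; lia.
lia.
Qed.

(** After division, the covered part is at least [#|P| * #|I| / 2 ^ n0] central binomials, up to the
    factor [1 - L ^ 2 / m./2]. That factor tends to 1 as [m] grows with the packing fixed. *)
Lemma La_sharp_lower_central d (P : finPOrderType d) n0 (I : finType)
    (e : I -> {ffun P -> {set 'I_n0}}) lev L m :
  0 < #|P| -> leveled_packing e lev -> (forall i, lev i <= L) ->
  #|P| * #|I| * (m./2 - L ^ 2) * 'C(n0 + m, (n0 + m)./2) <=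
    La_sharp P (n0 + m) * m./2 * 2 ^ n0.
Proof.
move=> P_gt0 pack_e levL; set h := m./2; have := La_sharp_lower m P_gt0 pack_e.
have := central_bin_add n0 m.
set La := La_sharp _ _; set Cn := 'C(n0 + m, _); set Cm := 'C(m, _) => le_Cn le_La.
have le_sum : #|I| * (h - L ^ 2) * Cm <= (\sum_i 'C(m, m./2 + lev i)) * h.
  rewrite -mulnA -sum_nat_const big_distrl; apply: leq_sum => i _ /=.
  have := bin_half_shift m (lev i); rewrite -/h -/Cm => le_i.
  rewrite mulnBl leq_subLR addnC [h * _]mulnC (leq_trans le_i) //.
  by rewrite leq_add2l leq_mul2r leq_exp2r ?levL ?orbT.
apply: leq_trans (leq_mul (leqnn _) le_Cn) _.
rewrite [2 ^ n0 * _]mulnC mulnA leq_mul2r; apply/orP; right.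
apply: leq_trans (leq_mul le_La (leqnn h)).
by rewrite -[X in _ <= X]mulnA -2!mulnA leq_mul2l mulnA le_sum orbT.
Qed.

(** * Asymptotics *)

From mathcomp Require Import boolp classical_sets functions reals topology normedtype landau.
From mathcomp Require Import sequences.
Import Order.TTheory GRing.Theory Num.Theory.
Import numFieldNormedType.Exports.
Local Open Scope classical_set_scope.
Local Open Scope ring_scope.

Lemma La_sharp_upper_near (R : realType) d (P : finPOrderType d) (eps : R) :
  0 < eps -> (0 < #|P|)%N ->
  \forall n \near \oo, (La_sharp P n)%:R <=
    (1 + eps) * (#|P|%:R / (min_hull P)%:R * ('C(n, n./2))%:R).
Proof.
move=> eps_gt0 P_gt0; set c := min_hull P.
have c_gt0 : (0 : R) < c%:R by rewrite ltr0n min_hull_gt0.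
near=> n.
(* This threshold is exactly the condition [(1 + eps) * (n - 2 * c) >= n]. *)
have le_n : 2 * c%:R * (1 + eps) / eps <= n%:R :> R by near: n; exact: nbhs_infty_ger.
have {}le_n : 2 * c%:R * (1 + eps) <= eps * n%:R by rewrite -ler_pdivrMl // mulrC.
have lt_n : 2 * c%:R < n%:R :> R.
  rewrite -(ltr_pM2l eps_gt0); apply: lt_le_trans le_n.
  move: c_gt0; set x := c%:R; nra.
have := La_sharp_upper n P_gt0; rewrite -/c -(ler_nat R) !natrM natrB; last first.
  by rewrite -(ler_nat R) natrM; exact: ltW.
rewrite natrM; set a := (La_sharp P n)%:R; set C := ('C(_, _))%:R; set p := #|P|%:R.
move=> le_a; have -> : (1 + eps) * (p / c%:R * C) = (1 + eps) * (p * C) / c%:R by ring.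
rewrite ler_pdivlMr // -(ler_pM2r (x := n%:R - 2 * c%:R)) ?subr_gt0 //.
rewrite mulrA in le_a; apply: le_trans le_a _; rewrite mulrCA.
have : 0 <= p * C by rewrite mulr_ge0.
by move: (p * C) => y y_ge0; have := ler_wpM2l y_ge0 le_n; lra.
Unshelve. all: by end_near.
Qed.

Lemma expn_ratio_small (R : realType) (q K : nat) (del : R) :
  0 < del -> (q < K)%N -> exists t, ((q ^ t)%N)%:R <= del * ((K ^ t)%N)%:R.
Proof.
move=> del_gt0 lt_qK; have K_gt0 : (0 : R) < K%:R by rewrite ltr0n (leq_ltn_trans _ lt_qK).
have z_lt1 : `|q%:R / K%:R : R| < 1.
  by rewrite ger0_norm ?divr_ge0 // ltr_pdivrMr // mul1r ltr_nat.
have /cvgrPdist_le/(_ _ del_gt0)[t _ /(_ t (leqnn t))] := cvg_expr z_lt1.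
rewrite /= sub0r normrN ger0_norm ?exprn_ge0 ?divr_ge0 // => le_t; exists t.
by rewrite !natrX -ler_pdivrMr ?exprn_gt0 // -expr_div_n.
Qed.

Lemma La_sharp_lower_near (R : realType) d (P : finPOrderType d) (eps : R) :
  0 < eps -> (0 < #|P|)%N ->
  \forall n \near \oo,
    (1 - eps) * (#|P|%:R / (min_hull P)%:R * ('C(n, n./2))%:R) <= (La_sharp P n)%:R.
Proof.
move=> eps_gt0 P_gt0; have c_gt0 := min_hull_gt0 P_gt0.
have [k [f [fw eq_c]]] := min_hull_attained P.
have lt_qK : (2 ^ k - min_hull P < 2 ^ k)%N by rewrite ltn_subrL c_gt0 expn_gt0.
have eps2 : 0 < eps / 2 by rewrite divr_gt0.
(* Half of [eps] pays for the uncovered share [(1 - c / 2 ^ k) ^ t]; the other half pays for the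
   shift from the middle, [L ^ 2 / h]. *)
have [t le_t] := expn_ratio_small eps2 lt_qK.
have [n0 [I [e [lev [pack_e]]]]] := leveled_packing_exists t fw.
rewrite /= eq_c; set c := min_hull P in c_gt0 le_t * => eq_card.
have le_M : (1 - eps / 2) * (2 ^ n0)%N%:R <= c%:R * #|I|%:R :> R.
  have K_gt0 : 0 < ((2 ^ k) ^ t)%N%:R :> R by rewrite ltr0n !expn_gt0.
  have := congr1 (fun x : nat => x%:R : R) eq_card; rewrite natrD !natrM => eq_card_R.
  have N_ge0 : (0 : R) <= (2 ^ n0)%N%:R by [].
  rewrite -(ler_pM2r K_gt0); have := ler_wpM2l N_ge0 le_t; lra.
pose L := \max_i lev i; have levL i : (lev i <= L)%N by exact: leq_bigmax.
have [X _ leX] : \forall x \near \oo, 2 * (L ^ 2)%N%:R / eps <= x%:R :> R.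
  exact: nbhs_infty_ger.
near=> n.
(* This forces [h > X + L ^ 2], so that [h] is positive, [h - L ^ 2] is not truncated, and
   [2 * L ^ 2 <= eps * h]. *)
have le_n : (n0 + (X + L ^ 2).+1.*2 <= n)%N by near: n; exact: nbhs_infty_ge.
have le_n0n : (n0 <= n)%N by apply: leq_trans le_n; rewrite leq_addr.
have := La_sharp_lower_central (n - n0) P_gt0 pack_e levL; rewrite subnKC //.
set h := (n - n0)./2.
have le_Xh : (X + L ^ 2 < h)%N by rewrite -[(_ < _)%N]leq_double /h; lia.
have : 2 * (L ^ 2)%N%:R / eps <= h%:R :> R.
  by apply: leX; rewrite /= (leq_trans (leq_addr _ _) (ltnW le_Xh)).
have h_gt0 : (0 : R) < h%:R by rewrite ltr0n (leq_ltn_trans _ le_Xh).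
rewrite ler_pdivrMr // => le_h.
rewrite -(ler_nat R) !natrM natrB; last by rewrite (leq_trans (leq_addl _ _) (ltnW le_Xh)).
set a := (La_sharp P n)%:R; set C := ('C(_, _))%:R; set p := #|P|%:R => le_a.
have c_gt0R : (0 : R) < c%:R by rewrite ltr0n.
have N_gt0 : (0 : R) < (2 ^ n0)%N%:R by rewrite ltr0n expn_gt0.
have -> : (1 - eps) * (p / c%:R * C) = (1 - eps) * (p * C) / c%:R by ring.
rewrite ler_pdivrMr // -(ler_pM2r (mulr_gt0 h_gt0 N_gt0)).
have y_ge0 : 0 <= p * C by rewrite mulr_ge0.
have L_le_h : (L ^ 2)%N%:R <= h%:R :> R.
  by rewrite ler_nat (leq_trans (leq_addl _ _) (ltnW le_Xh)).
have L_ge0 : (0 : R) <= (L ^ 2)%N%:R by [].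
move: le_a le_M le_h h_gt0 c_gt0R N_gt0 L_le_h L_ge0.
move: (h%:R) (c%:R) ((2 ^ n0)%N%:R) ((L ^ 2)%N%:R) (#|I|%:R) => x z N l M.
move=> le_a le_M le_h x_gt0 z_gt0 N_gt0 l_le_x l_ge0.
apply: (@le_trans _ _ ((p * C) * (x - l) * (z * M))); last first.
  have := ler_wpM2l (ltW z_gt0) le_a; lra.
apply: (@le_trans _ _ ((p * C) * (x - l) * ((1 - eps / 2) * N))); last first.
  by rewrite ler_wpM2l // mulr_ge0 // subr_ge0.
have key : (1 - eps) * x <= (x - l) * (1 - eps / 2).
  by have := mulr_ge0 l_ge0 (ltW eps_gt0); lra.
have := ler_wpM2l (mulr_ge0 y_ge0 (ltW N_gt0)) key; lra.
Unshelve. all: by end_near.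
Qed.

Theorem theorem3 (R : realType) (d : Order.disp_t) (P : finPOrderType d) :
  (fun n : nat => (La_sharp P n)%:R : R) ~_\oo
  ((fun n : nat => #|P|%:R / (min_hull P)%:R * ('C(n, n./2))%:R) : nat -> R).
Proof.
apply/eqaddoP => eps eps_gt0; have [P0|P_gt0] := posnP #|P|.
  (* For empty [P] every copy is the empty family, so both functions vanish identically. *)
  near=> n; rewrite !fctE /= P0 !mul0r !subr0 normr0 mulr0 normr_le0 pnatr_eq0 -leqn0.
  apply/bigmax_leqP => C /andP[/forall_inP copyC _].
  apply: leq_trans (leq_card_cover C) _; rewrite big1 // => F CF.
  by rewrite (card_copy (copyC _ CF)).
have upper := La_sharp_upper_near eps_gt0 P_gt0.
have lower := La_sharp_lower_near eps_gt0 P_gt0.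
near=> n; rewrite !fctE /=.
have b_ge0 : 0 <= #|P|%:R / (min_hull P)%:R * ('C(n, n./2))%:R :> R.
  by rewrite mulr_ge0 // divr_ge0.
rewrite [`|_ * _|]ger0_norm //.
rewrite ler_norml; apply/andP; split.
  suff : (1 - eps) * (#|P|%:R / (min_hull P)%:R * ('C(n, n./2))%:R) <= (La_sharp P n)%:R by lra.
  by near: n; exact: lower.
suff : (La_sharp P n)%:R <= (1 + eps) * (#|P|%:R / (min_hull P)%:R * ('C(n, n./2))%:R) by lra.
by near: n; exact: upper.
Unshelve. all: by end_near.
Qed.
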